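(* Assume there exists $(\gamma_0^*,\gamma^* )\in\Gamma$ with $A(\gamma_0^*,\gamma^* )\succ 0$. Suppose that for every $(x,t)\in\mathcal S_{\mathrm{SDP}}\setminus\mathcal S$ the set $\mathcal R'(x,t)$ is nontrivial (i.e., $\mathcal R'(x,t)\neq\{0\}$). Then $\operatorname{conv}(\mathcal S)=\mathcal S_{\mathrm{SDP}}$.
   Context: Let $n,m$ be positive integers. Let $\mathbb S^n$ be the real symmetric $n\times n$ matrices with trace inner product. For $i\in\{0,1,\dots,m\}$ let $q_i:\mathbb R^n\to\mathbb R$, $q_i(x)=x^\top A_i x+2b_i^\top x+c_i$ with $A_i\in\mathbb S^n$, $b_i\in\mathbb R^n$, $c_i\in\mathbb R$ (possibly nonconvex); $q_0$ is the objective and $q_1,\dots,q_m$ are the constraints. Let $q(x)=(q_0(x),\dots,q_m(x))\in\mathbb R^{1+m}$ and let $e_0\in\mathbb R^{1+m}$ be the unit vector of the coordinate indexed $0$. For $(\gamma_0,\gamma)\in\mathbb R^{1+m}$ let $A(\gamma_0,\gamma)=\sum_{i=0}^m\gamma_iA_i$. Define $$\Gamma=\{(\gamma_0,\gamma)\in\mathbb R_+\times\mathbb R_+^m: A(\gamma_0,\gamma)\succeq 0\}.$$ Epigraph of the QCQP: $\mathcal S=\{(x,t)\in\mathbb R^n\times\mathbb R: q_0(x)\le 2t,\ q_i(x)\le 0\ \forall i\in\{1,\dots,m\}\}$. Projected SDP relaxation: $\mathcal S_{\mathrm{SDP}}$ is the set of $(x,t)\in\mathbb R^n\times\mathbb R$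 for which there is $X\in\mathbb S^n$ with $X\succeq xx^\top$, $\langle A_0,X\rangle+2b_0^\top x+c_0\le 2t$, and $\langle A_i,X\rangle+2b_i^\top x+c_i\le 0$ for all $i\in\{1,\dots,m\}$. Polar cone: $\Gamma^\circ=\{y\in\mathbb R^{1+m}:\langle y,g\rangle\le 0\ \forall g\in\Gamma\}$. Under the assumption in the claim, $(x,t)\in\mathcal S_{\mathrm{SDP}}$ if and only if $q(x)-2te_0\in\Gamma^\circ$. Faces of cones are nonempty by convention. For $(x,t)\in\mathcal S_{\mathrm{SDP}}$, let $\mathcal G(x,t)$ be the minimal face of $\Gamma^\circ$ containing $q(x)-2te_0$, and define $$\mathcal R'(x,t)=\{(x',t')\in\mathbb R^{n+1}: q(x+\alpha x')-2(t+\alpha t')e_0\in\operatorname{span}(\mathcal G(x,t))\ \ \forall\alpha\in\mathbb R\}.$$ *)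

(* Defs.v *)
From mathcomp Require Export all_boot all_order all_algebra.
From mathcomp Require Export boolp classical_sets reals convex.

Set Implicit Arguments.
Unset Strict Implicit.
Unset Printing Implicit Defensive.
Import Order.TTheory GRing.Theory Num.Theory.
Local Open Scope classical_set_scope.
Local Open Scope ring_scope.

Section ConvexGeometry.
Variable R : realType.

Definition conv_hull (V : lmodType R) (E : set V) : set V :=
  smallest (@convex_set R V) E.

(* [<<s>>%VS] spans a finite sequence; a linear combination of elements of an
   arbitrary set [E] only involves finitely many of them. *)
Definition lspan (V : vectType R) (E : set V) : set V :=
  [set v | exists s : seq V, (forall u, u \in s -> E u) /\ v \in <<s>>%VS].

(* When [K] is a convex cone, such an [F] is automatically a convex cone. *)
Definition is_face (V : lmodType R) (K F : set V) : Prop :=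
  [/\ F !=set0, F `<=` K, @convex_set R V F &
      forall (x y : V) (k : R), K x -> K y -> 0 < k < 1 ->
        F (k *: x + (1 - k) *: y) -> F x /\ F y].

(* Faces containing a given point of [K] are stable under intersection, so this
   is itself a face of [K] when [K] is convex and contains [y]. *)
Definition min_face (V : lmodType R) (K : set V) (y : V) : set V :=
  smallest (is_face K) [set y].

Definition dot (k : nat) (u v : 'cV[R]_k) : R := (u^T *m v) 0 0.

Definition polar (k : nat) (C : set 'cV[R]_k) : set 'cV[R]_k :=
  [set y | forall g, C g -> dot y g <= 0].

Definition psd (n : nat) (M : 'M[R]_n) : Prop :=
  M \is symmetricmx /\ forall x : 'cV[R]_n, 0 <= dot x (M *m x).

Definition posdef (n : nat) (M : 'M[R]_n) : Prop :=
  M \is symmetricmx /\ forall x : 'cV[R]_n, x != 0 -> 0 < dot x (M *m x).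

End ConvexGeometry.

Section QCQP.
(* The quadratic functions are indexed by ['I_m.+1]: index [ord0] is the
   objective and the indices [lift ord0 i], [i : 'I_m], are the constraints. *)
Variables (R : realType) (n m : nat).
Variables (A : 'I_m.+1 -> 'M[R]_n) (b : 'I_m.+1 -> 'cV[R]_n) (c : 'I_m.+1 -> R).

(* [R^o] is [R] seen as a module over itself, which makes the product a module. *)
Local Notation point := ('cV[R]_n * R^o)%type.

Definition quad (i : 'I_m.+1) (x : 'cV[R]_n) : R :=
  dot x (A i *m x) + 2 * dot (b i) x + c i.

Definition qvec (x : 'cV[R]_n) : 'cV[R]_m.+1 := \col_i quad i x.

Definition e0 : 'cV[R]_m.+1 := delta_mx ord0 0.

Definition Aagg (g : 'cV[R]_m.+1) : 'M[R]_n := \sum_i g i 0 *: A i.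

Definition Gamma : set 'cV[R]_m.+1 :=
  [set g : 'cV[R]_m.+1 | (forall i, 0 <= g i 0) /\ psd (Aagg g)].

Definition epi : set point :=
  [set p | quad ord0 p.1 <= 2 * p.2 /\
           forall i : 'I_m, quad (lift ord0 i) p.1 <= 0].

Definition lifted (i : 'I_m.+1) (X : 'M[R]_n) (x : 'cV[R]_n) : R :=
  \tr (A i *m X) + 2 * dot (b i) x + c i.

Definition epi_sdp : set point :=
  [set p | exists X : 'M[R]_n,
     [/\ X \is symmetricmx, psd (X - p.1 *m p.1^T),
         lifted ord0 X p.1 <= 2 * p.2 &
         forall i : 'I_m, lifted (lift ord0 i) X p.1 <= 0]].

Definition Gface (p : point) : set 'cV[R]_m.+1 :=
  min_face (polar Gamma) (qvec p.1 - (2 * p.2) *: e0).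

Definition Rprime (p : point) : set point :=
  [set d | forall a : R,
     lspan (Gface p) (qvec (p.1 + a *: d.1) - (2 * (p.2 + a * d.2)) *: e0)].

End QCQP.

(* Main.v *)
Require Import Defs.
From mathcomp Require Import ring lra.
From mathcomp Require Import interval_inference.
From mathcomp Require Import topology normedtype derive.
Import Order.TTheory GRing.Theory Num.Theory.
Local Open Scope classical_set_scope.
Local Open Scope ring_scope.
Set Implicit Arguments.
Unset Strict Implicit.

(** Write [q(x) - 2 t e_0] for the vector attached to a point [p = (x, t)], and
    [K] for the polar of [Gamma].

    Conic duality.  A point lies in the projected SDP relaxation iff its vector
    lies in [K] ([epi_sdp_polar]).  One direction holds because the trace of a
    product of two positive semidefinite matrices is nonnegative.  For the other
    ([sdp_duality]), given [y] in [K], minimise over [Z] positive semidefinite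
    the sum over [i] of the squared positive parts of [tr (A_i Z) + y_i].  A
    positive definite aggregate makes sublevel sets bounded, so a minimiser
    exists; its first-order conditions say that the residual [r] belongs to
    [Gamma] and satisfies [tr (A(r) Z) <= 0], whence [|r|^2 <= <y, r> <= 0] and
    the residual vanishes.  With [X = Z + x x^T] this is feasibility in the
    relaxation.  In particular the relaxation is convex and contains the
    epigraph, which gives one inclusion.

    Facial descent.  For [y] in the convex cone [K], let [L(y)] be the space of
    directions along which one can move a little both ways from [y] inside [K].
    The set [K] meets [L(y)] in a face containing [y], so the span of the minimal
    face of [y] is contained in [L(y)] ([lspan_min_face_sub]).  Let [p] be a
    point of the relaxation outside the epigraph, and [d] a nonzero element of
    [Rprime p].  The vector of [p + a d] is a quadratic function [y + a u + a^2 w]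
    with [u] and [w] in [L(y)].  Followed until it leaves [K], it stops at a
    point [z] of [K] with [L(z)] strictly inside [L(y)] ([polar_exit]), so an
    induction on the dimension of [L] puts the corresponding point in the convex
    hull.  If the [x]-part of [d] is nonzero, the path leaves [K] in both
    directions, since a positive definite aggregate makes the pairing with a
    multiplier grow quadratically, and [p] lies between the two exit points.  If
    [d] is vertical, the path leaves [K] downwards, since some multiplier has a
    positive objective weight, and [p] lies above the exit point; the convex hull
    of the epigraph is stable under upward translation ([epi_sdp_sub_conv_hull]). *)

(** * Positive semidefinite matrices *)

Section Dot.
Variables (R : realType) (n : nat).
Implicit Types (u v x y : 'cV[R]_n) (P Q : 'M[R]_n) (a : R).

Lemma dotE u v : dot u v = \sum_i u i 0 * v i 0.
Proof. by rewrite /dot mxE; apply: eq_bigr => i _; rewrite mxE. Qed.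

Lemma dotC u v : dot u v = dot v u.
Proof. by rewrite !dotE; apply: eq_bigr => i _; rewrite mulrC. Qed.

Lemma dotDl u v x : dot (u + v) x = dot u x + dot v x.
Proof. by rewrite /dot linearD mulmxDl mxE. Qed.

Lemma dotDr u v x : dot x (u + v) = dot x u + dot x v.
Proof. by rewrite /dot mulmxDr mxE. Qed.

Lemma dotZl a u x : dot (a *: u) x = a * dot u x.
Proof. by rewrite /dot linearZ -scalemxAl mxE. Qed.

Lemma dotZr a u x : dot x (a *: u) = a * dot x u.
Proof. by rewrite /dot -scalemxAr mxE. Qed.

Lemma dot0r x : dot x 0 = 0.
Proof. by rewrite /dot mulmx0 mxE. Qed.

Lemma dot0l x : dot 0 x = 0.
Proof. by rewrite dotC dot0r. Qed.

Lemma dotNr u x : dot x (- u) = - dot x u.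
Proof. by rewrite /dot mulmxN mxE. Qed.

Lemma dotNl u x : dot (- u) x = - dot u x.
Proof. by rewrite dotC dotNr dotC. Qed.

Lemma dot_ge0 x : 0 <= dot x x.
Proof. by rewrite dotE; apply: sumr_ge0 => i _; rewrite -expr2 sqr_ge0. Qed.

Lemma dot_eq0 x : (dot x x == 0) = (x == 0).
Proof.
apply/eqP/eqP => [|->]; last exact: dot0r.
rewrite dotE => /eqP; rewrite psumr_eq0 => [|i _]; last by rewrite -expr2 sqr_ge0.
move=> /allP h; apply/matrixP => i j; rewrite ord1 mxE; apply/eqP.
by have := h i (mem_index_enum i); rewrite /= mulf_eq0 orbb.
Qed.

Lemma dot_gt0 x : x != 0 -> 0 < dot x x.
Proof. by move=> x0; rewrite lt_def dot_ge0 andbT dot_eq0. Qed.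

Lemma dot_delta_l i x : dot (delta_mx i 0) x = x i 0.
Proof.
rewrite dotE (bigD1 i)//= mxE !eqxx mul1r big1 ?addr0// => j ji.
by rewrite mxE (negbTE ji) mul0r.
Qed.

Lemma dot_delta_mx P i j :
  dot (delta_mx i 0) (P *m delta_mx j 0) = P i j.
Proof. by rewrite dot_delta_l -colE mxE. Qed.

Lemma dot_mulmx u P v : dot u (P *m v) = \sum_i \sum_j u i 0 * P i j * v j 0.
Proof.
rewrite dotE; apply: eq_bigr => i _; rewrite mxE mulr_sumr.
by apply: eq_bigr => j _; rewrite mulrA.
Qed.

Lemma symmetricmxP P : reflect (P^T = P) (P \is symmetricmx).
Proof.
by rewrite is_hermitianmxE expr0 scale1r map_mx_id // eq_sym; exact: eqP.
Qed.

Lemma dot_trmx P u v : dot u (P^T *m v) = dot (P *m u) v.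
Proof. by rewrite /dot trmx_mul mulmxA. Qed.

Lemma dot_sym P u v : P \is symmetricmx -> dot u (P *m v) = dot v (P *m u).
Proof. by move=> /symmetricmxP hP; rewrite -{1}hP dot_trmx dotC. Qed.

Lemma quadratic_form_line P x y a : P \is symmetricmx ->
  dot (x + a *: y) (P *m (x + a *: y)) =
  dot x (P *m x) + a * (2 * dot x (P *m y)) + a ^+ 2 * dot y (P *m y).
Proof.
move=> hP; rewrite mulmxDr -scalemxAr !dotDl !dotDr !dotZl !dotZr.
by rewrite (dot_sym y x hP); ring.
Qed.

Lemma quadratic_formD P Q x :
  dot x ((P + Q) *m x) = dot x (P *m x) + dot x (Q *m x).
Proof. by rewrite mulmxDl dotDr. Qed.

Lemma quadratic_formZ a P x : dot x ((a *: P) *m x) = a * dot x (P *m x).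
Proof. by rewrite -scalemxAl dotZr. Qed.

Lemma quadratic_form_outer v x : dot x ((v *m v^T) *m x) = dot v x ^+ 2.
Proof.
rewrite -mulmxA (_ : v^T *m x = (dot v x)%:M); last first.
  by apply/matrixP => i j; rewrite !ord1 [RHS]mxE eqxx mulr1n.
by rewrite mul_mx_scalar dotZr dotC expr2.
Qed.

Lemma outer_sym v : v *m v^T \is symmetricmx.
Proof. by apply/symmetricmxP; rewrite trmx_mul trmxK. Qed.

Lemma psd_outer v : psd (v *m v^T).
Proof.
by split; [exact: outer_sym | move=> x; rewrite quadratic_form_outer sqr_ge0].
Qed.

Lemma symD P Q : P \is symmetricmx -> Q \is symmetricmx -> P + Q \is symmetricmx.
Proof.
by move=> /symmetricmxP hP /symmetricmxP hQ; apply/symmetricmxP; rewrite linearD /= hP hQ.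
Qed.

Lemma symZ a P : P \is symmetricmx -> a *: P \is symmetricmx.
Proof.
by move=> /symmetricmxP hP; apply/symmetricmxP; rewrite linearZ /= hP.
Qed.

Lemma psd0 : psd (0 : 'M[R]_n).
Proof.
split; first by apply/symmetricmxP; rewrite trmx0.
by move=> x; rewrite mul0mx dot0r.
Qed.

Lemma psdD P Q : psd P -> psd Q -> psd (P + Q).
Proof.
move=> [hP P0] [hQ Q0]; split; first exact: symD.
by move=> x; rewrite quadratic_formD addr_ge0.
Qed.

Lemma psdZ a P : 0 <= a -> psd P -> psd (a *: P).
Proof.
move=> a0 [hP P0]; split; first exact: symZ.
by move=> x; rewrite quadratic_formZ mulr_ge0.
Qed.

(** The Cauchy-Schwarz inequality for the semi-inner product of a positive
    semidefinite matrix: the quadratic form is nonnegative along the line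
    through [x] in direction [y], hence its discriminant is nonpositive. *)
Lemma psd_cauchy_schwarz P x y : psd P ->
  dot x (P *m y) ^+ 2 <= dot x (P *m x) * dot y (P *m y).
Proof.
move=> [hP P0].
set s := dot x (P *m y); set p := dot x (P *m x); set q := dot y (P *m y).
have line a : 0 <= p + a * (2 * s) + a ^+ 2 * q.
  by rewrite -quadratic_form_line//; exact: P0.
have p0 : 0 <= p by exact: P0.
have q0 : 0 <= q by exact: P0.
have [qz|qn] := eqVneq q 0; last first.
  have qp : 0 < q by rewrite lt_def qn q0.
  have := line (- s / q).
  rewrite (_ : _ + _ = (p * q - s ^+ 2) / q); last by field.
  by rewrite pmulr_lge0 ?invr_gt0// subr_ge0.
(* A vanishing leading coefficient forces the line to be constant. *)
have [->|sn] := eqVneq s 0; first by rewrite qz mulr0 expr0n.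
have := line (- (p + 1) / (2 * s)).
rewrite qz mulr0 addr0 (_ : _ + _ = -1); last by field.
by rewrite ler0N1.
Qed.

Lemma mxtrace_outer P v : \tr (P *m (v *m v^T)) = dot v (P *m v).
Proof. by rewrite mulmxA mxtrace_mulC /dot /mxtrace big_ord1. Qed.

(** The constant is one plus the sum of the absolute values of the entries. *)
Lemma quadratic_form_ge P :
  exists2 M, 0 < M & forall x, - M * dot x x <= dot x (P *m x).
Proof.
exists (1 + \sum_i \sum_j `|P i j|).
  by rewrite ltr_pwDl// sumr_ge0// => i _; apply: sumr_ge0.
move=> x; rewrite dot_mulmx.
have h i : x i 0 ^+ 2 <= dot x x.
  rewrite dotE (bigD1 i)//= -expr2 lerDl; apply: sumr_ge0 => j _.
  by rewrite -expr2 sqr_ge0.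
have le1 : - (\sum_i \sum_j `|P i j|) * dot x x <=
    \sum_i \sum_j x i 0 * P i j * x j 0.
  rewrite mulNr mulr_suml -sumrN; apply: ler_sum => i _.
  rewrite mulr_suml -sumrN; apply: ler_sum => j _.
  have hij : `|x i 0 * x j 0| <= dot x x.
    have := h i; have := h j; have := sqr_ge0 (x i 0 - x j 0).
    have := sqr_ge0 (x i 0 + x j 0).
    by rewrite ler_norml => *; apply/andP; split; nra.
  rewrite mulrAC -lerN2 opprK.
  apply: le_trans (ler_norm _) _.
  by rewrite normrN mulrC normrM ler_wpM2l.
apply: le_trans le1; rewrite ler_wpM2r ?dot_ge0// lerN2 lerDr //.
Qed.

Lemma posdef_unitmx P : posdef P -> P \in unitmx.
Proof.
move=> [hP P0]; rewrite unitmxE unitfE; apply/negP => /det0P [v v0 vP].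
have : 0 < dot v^T (P *m v^T).
  by apply: P0; apply: contra v0 => /eqP h; rewrite -[v]trmxK h trmx0.
by rewrite -[P in P *m _](symmetricmxP _ hP) -trmx_mul vP trmx0 dot0r ltxx.
Qed.

Lemma posdef_psd P : posdef P -> psd P.
Proof.
move=> [hP P0]; split=> // x; have [->|/P0/ltW//] := eqVneq x 0.
by rewrite dot0l.
Qed.

(** Coercivity of a positive definite form.  Applying Cauchy-Schwarz to [x] and
    [P^-1 x] bounds [|x|^4] by [x^T P x] times [x^T P^-1 x], and the latter is at
    most a multiple of [|x|^2]. *)
Lemma posdef_coercive P : posdef P ->
  exists2 l, 0 < l & forall x, l * dot x x <= dot x (P *m x).
Proof.
move=> hP; have uP := posdef_unitmx hP.
have [M M0 hM] := quadratic_form_ge (- invmx P).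
exists M^-1; first by rewrite invr_gt0.
move=> x; have [->|x0] := eqVneq x 0; first by rewrite !dot0l mulr0.
have dx := dot_gt0 x0.
(* With [y = P^-1 x] the middle term of Cauchy-Schwarz is [x^T x]. *)
have := psd_cauchy_schwarz x (invmx P *m x) (posdef_psd hP).
rewrite mulmxA mulmxV// mul1mx [dot (invmx P *m x) x]dotC => cs.
have hM' : dot x (invmx P *m x) <= M * dot x x.
  by have := hM x; rewrite mulNmx dotNr mulNr lerN2.
have P0 : 0 <= dot x (P *m x) by case: (posdef_psd hP).
rewrite mulrC ler_pdivrMr// -(ler_pM2r dx) -expr2.
apply: le_trans cs _; rewrite -mulrA; exact: ler_wpM2l.
Qed.

(** Symmetric Gaussian elimination: subtracting a rank-one matrix from a positive
    semidefinite matrix clears its [k]-th row and keeps it positive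
    semidefinite, as well as the rows that are already zero. *)
Lemma psd_elimination P (k : 'I_n) : psd P ->
  exists v, [/\ psd (P - v *m v^T), forall j, (P - v *m v^T) k j = 0
    & forall i, (forall j, P i j = 0) -> forall j, (P - v *m v^T) i j = 0].
Proof.
move=> hP; have [sP P0] := hP; have /symmetricmxP tP := sP.
have dk0 : 0 <= P k k by rewrite -dot_delta_mx; exact: P0.
have row0 : P k k = 0 -> forall j, P k j = 0.
  move=> pk j; have := psd_cauchy_schwarz (delta_mx k 0) (delta_mx j 0) hP.
  rewrite !dot_delta_mx pk mul0r => h; apply/eqP.
  by rewrite -sqrf_eq0 eq_le h sqr_ge0.
have [pk|pk] := eqVneq (P k k) 0.
  by exists 0; rewrite mul0mx subr0; split => //; exact: row0.
have pk0 : 0 < P k k by rewrite lt_def pk dk0.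
have sq : Num.sqrt (P k k) ^+ 2 = P k k by rewrite sqr_sqrtr.
have s0 : Num.sqrt (P k k) != 0 by rewrite sqrtr_eq0 -ltNge.
set s := Num.sqrt (P k k) in sq s0.
(* The outer product of [v] is the rank-one matrix with the same row [k] as [P]. *)
pose v := s^-1 *: col k P.
have vE i : v i 0 = s^-1 * P i k by rewrite !mxE.
have oE i j : (P - v *m v^T) i j = P i j - (P k k)^-1 * (P i k * P k j).
  rewrite [LHS]mxE; congr (_ + _); rewrite mxE; congr (- _).
  rewrite mxE big_ord1 vE mxE vE -sq.
  have -> : P j k = P k j by rewrite -[in LHS]tP mxE.
  by field.
exists v; split.
- split.
    by apply: symD => //; rewrite -scaleN1r; apply/symZ/outer_sym.
  move=> x; rewrite mulmxBl dotDr dotNr subr_ge0 quadratic_form_outer.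
  rewrite dotZl exprMn exprVn sq mulrC ler_pdivrMr //.
  have := psd_cauchy_schwarz x (delta_mx k 0) hP.
  by rewrite dot_delta_mx -colE dotC.
- by move=> j; rewrite oE mulrA mulVf // mul1r subrr.
- by move=> i pi j; rewrite oE !pi mul0r mulr0 subrr.
Qed.

Lemma psd_outer_sum P : psd P ->
  exists s : seq 'cV[R]_n, P = \sum_(v <- s) v *m v^T.
Proof.
move=> hP.
suff elim k : (k <= n)%N ->
    exists s : seq 'cV[R]_n, psd (P - \sum_(v <- s) v *m v^T) /\
    forall i : 'I_n, (i < k)%N -> forall j, (P - \sum_(v <- s) v *m v^T) i j = 0.
  have [s [_ hs]] := elim n (leqnn n).
  exists s; apply/eqP; rewrite -subr_eq0; apply/eqP/matrixP => i j.
  by rewrite hs // mxE.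
elim: k => [|k IH] kn.
  by exists [::]; rewrite big_nil subr0.
have [s [ps zs]] := IH (ltnW kn).
have [v [pv zv kv]] := psd_elimination (Ordinal kn) ps.
exists (v :: s); rewrite big_cons [v *m _ + _]addrC opprD addrA; split => //.
move=> i; rewrite ltnS leq_eqVlt => /orP[/eqP ik|ik]; last exact/kv/zs.
have -> : i = Ordinal kn by apply: val_inj.
exact: zv.
Qed.

Lemma mxtrace_psd_ge0 P Q : (forall x, 0 <= dot x (P *m x)) -> psd Q ->
  0 <= \tr (P *m Q).
Proof.
move=> P0 /psd_outer_sum [s ->]; rewrite mulmx_sumr linear_sum /=.
by apply: sumr_ge0 => v _; rewrite mxtrace_outer.
Qed.

(** By the nonnegativity of the two-by-two principal minors, which is
    Cauchy-Schwarz for the unit vectors [i] and [j]. *)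
Lemma psd_norm_le_trace P i j : psd P -> `|P i j| <= \tr P.
Proof.
move=> hP; have [sP P0] := hP; have /symmetricmxP tP := sP.
have d0 k : 0 <= P k k by rewrite -dot_delta_mx; exact: P0.
have le k : P k k <= \tr P.
  by rewrite /mxtrace (bigD1 k)//= lerDl sumr_ge0.
have cs := psd_cauchy_schwarz (delta_mx i 0) (delta_mx j 0) hP.
rewrite !dot_delta_mx in cs.
have t0 : 0 <= \tr P by apply: sumr_ge0.
rewrite -(ler_pXn2r (_ : 0 < 2)%N) ?nnegrE//.
rewrite real_normK ?num_real//; apply: le_trans cs _.
by rewrite expr2 ler_pM.
Qed.

End Dot.

(** * Duality for the semidefinite cone *)

Import numFieldNormedType.Exports.

Lemma sum_continuous (R : realType) (T : topologicalType) (I : finType)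
    (F : I -> T -> R) :
  (forall i, continuous (F i)) -> continuous (fun x => \sum_i F i x).
Proof.
move=> hF; apply: (@continuous_big R I +%R 0 xpredT _ T _ F) => //.
exact: (@pseudometric_normed_Zmodule.add_continuous R R^o).
Qed.

Section Duality.
Variables (R : realType) (n : nat).
Implicit Types (P Q Z : 'M[R]_n).

Lemma continuous_mxtrace_mul P : continuous (fun Z : 'M[R]_n => \tr (P *m Z)).
Proof.
have -> : (fun Z => \tr (P *m Z)) = fun Z : 'M[R]_n => \sum_i \sum_j P i j * Z j i.
  by apply: boolp.funext => Z; apply: eq_bigr => i _; rewrite mxE.
apply: (@sum_continuous R) => i.
apply: (@sum_continuous R) => j.
move=> Z; apply: (@continuousM R _ (fun=> P i j) (fun Z => Z j i) Z).
  exact: cst_continuous.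
exact: coord_continuous.
Qed.

Lemma closed_psd : closed [set Z : 'M[R]_n | psd Z].
Proof.
have -> : [set Z : 'M[R]_n | psd Z] =
    (\bigcap_i \bigcap_j [set Z : 'M[R]_n | Z i j - Z j i = 0]) `&`
    (\bigcap_(x in [set: 'cV[R]_n]) [set Z : 'M[R]_n | 0 <= \tr ((x *m x^T) *m Z)]).
  apply/seteqP; split => Z /=.
    move=> [/symmetricmxP sZ Z0]; split=> [i _ j _|x _] /=.
      by rewrite -{1}sZ mxE subrr.
    by rewrite mxtrace_mulC mxtrace_outer.
  move=> [sZ Z0]; split.
    apply/symmetricmxP/matrixP => i j; rewrite mxE; apply/eqP.
    by rewrite -subr_eq0; apply/eqP; exact: (sZ j I i I).
  by move=> x; have := Z0 x I; rewrite /= mxtrace_mulC mxtrace_outer.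
apply: closedI.
  apply: closed_bigI => i _; apply: closed_bigI => j _.
  apply: (@preimage_closed _ _ (fun Z : 'M[R]_n => Z i j - Z j i) [set x | x = 0]).
    move=> Z _; apply: (@continuousB R R^o _ (fun Z : 'M[R]_n => Z i j)
      (fun Z => Z j i) Z); exact: coord_continuous.
  exact: closed_eq.
apply: closed_bigI => x _.
apply: (@preimage_closed _ _ (fun Z => \tr ((x *m x^T) *m Z)) [set t | 0 <= t]).
  by move=> Z _; exact: continuous_mxtrace_mul.
exact: closed_ge.
Qed.

Lemma continuous_vec_mx : continuous (@vec_mx R n n).
Proof.
move=> z s /= /(nbhs_ballP (vec_mx z)) [e e0 es].
apply/nbhs_ballP; exists e => //= z' [_ zz']; apply: es; split => // i j.
by rewrite !mxE; exact: zz'.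
Qed.

Lemma compact_psd_trace_le (B : R) :
  compact [set Z : 'M[R]_n | psd Z /\ \tr Z <= B].
Proof.
pose box := [set v : 'rV[R]_(n * n) | forall i, v 0 i \in `[- B, B]].
have cbox : compact (@vec_mx R n n @` box).
  apply: continuous_compact; first exact/continuous_subspaceT/continuous_vec_mx.
  apply: (@rV_compact _ _ (fun=> `[- B, B]%classic)) => _.
  exact: segment_compact.
apply: subclosed_compact cbox _.
  rewrite (_ : mkset _ = [set Z | psd Z] `&` [set Z | \tr (1%:M *m Z) <= B]).
    apply: closedI; first exact: closed_psd.
    apply: (@preimage_closed _ _ (fun Z => \tr (1%:M *m Z)) [set t | t <= B]).
      by move=> Z _; exact: continuous_mxtrace_mul.
    exact: closed_le.
  by apply/seteqP; split => Z /=; rewrite mul1mx.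
move=> Z [pZ tZ]; exists (mxvec Z); last exact: mxvecK.
move=> k; case/mxvec_indexP: k => i j; rewrite mxvecE in_itv /= -ler_norml.
exact: le_trans (psd_norm_le_trace i j pZ) tZ.
Qed.

(** A continuous function on the positive semidefinite cone attains its minimum
    as soon as its sublevel set at [0] has bounded trace. *)
Lemma psd_attains_min (f : 'M[R]_n -> R) (B : R) : continuous f ->
  (forall Z, psd Z -> f Z <= f 0 -> \tr Z <= B) ->
  exists2 Z0, psd Z0 & forall Z, psd Z -> f Z0 <= f Z.
Proof.
move=> cf hB.
have K0 : [set Z : 'M[R]_n | psd Z /\ \tr Z <= B] 0.
  by split; [exact: psd0 | apply: hB => //; exact: psd0].
have [] := @compact_EVT_min _ _ f _ (ex_intro _ _ K0) (@compact_psd_trace_le B).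
  exact: continuous_subspaceT.
move=> Z0 /set_mem [pZ0 _] hmin; exists Z0 => // Z pZ.
have [fZ|/ltW fZ] := leP (f Z) (f 0).
  by apply: hmin; apply: mem_set; split => //; exact: hB.
by apply: le_trans fZ; apply: hmin; exact: mem_set.
Qed.

Lemma posdef_trace_coercive P : posdef P ->
  exists2 l, 0 < l & forall Z, psd Z -> l * \tr Z <= \tr (P *m Z).
Proof.
move=> hP; have [l l0 hl] := posdef_coercive hP; exists l => // Z pZ.
rewrite -subr_ge0; have := @mxtrace_psd_ge0 _ _ (P - l%:M) Z _ pZ.
rewrite mulmxBl linearB /= mul_scalar_mx linearZ /=; apply=> x.
by rewrite mulmxBl dotDr dotNr mul_scalar_mx dotZr subr_ge0.
Qed.

(** The squared positive part has derivative twice the positive part, and lies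
    below its tangent parabola of leading coefficient one. *)
Lemma sqr_pospart_le (t h : R) :
  Num.max 0 (t + h) ^+ 2 <= Num.max 0 t ^+ 2 + 2 * Num.max 0 t * h + h ^+ 2.
Proof. by case: (leP 0 t); case: (leP 0 (t + h)) => *; nra. Qed.

Lemma quadratic_perturbation_ge0 (s C : R) :
  (forall e, 0 < e -> 0 <= e * s + e ^+ 2 * C) -> 0 <= s.
Proof.
move=> h; rewrite leNgt; apply/negP => s0.
pose D := Num.max 1 C; have D0 : 0 < D by rewrite /D lt_max ltr01.
have CD : C <= D by rewrite /D le_max lexx orbT.
(* Minimiser of [e * s + e ^+ 2 * D], as [s] is negative. *)
have e0 : 0 < - s / (2 * D) by apply: divr_gt0; rewrite ?oppr_gt0 ?mulr_gt0.
have := h _ e0; rewrite leNgt => /negP; apply.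
have -> : - s / (2 * D) * s + (- s / (2 * D)) ^+ 2 * C =
   (s ^+ 2 / (4 * D ^+ 2)) * (C - 2 * D).
  by field; rewrite gt_eqF.
have s2 : 0 < s ^+ 2 by rewrite expr2 nmulr_lgt0.
rewrite pmulr_rlt0; last by rewrite divr_gt0 // mulr_gt0 // exprn_gt0.
lra.
Qed.

End Duality.

Section ConicDuality.
Variables (R : realType) (n m : nat) (A : 'I_m.+1 -> 'M[R]_n).
Hypothesis hA : forall i, A i \is symmetricmx.

Lemma mxtrace_Aagg g Z : \tr (Aagg A g *m Z) = \sum_i g i 0 * \tr (A i *m Z).
Proof.
rewrite /Aagg mulmx_suml linear_sum /=; apply: eq_bigr => i _.
by rewrite -scalemxAl linearZ.
Qed.

Lemma Aagg_form g x : dot x (Aagg A g *m x) = \sum_i g i 0 * dot x (A i *m x).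
Proof.
rewrite -mxtrace_outer mxtrace_Aagg; apply: eq_bigr => i _.
by rewrite mxtrace_outer.
Qed.

Lemma Aagg_sym g : Aagg A g \is symmetricmx.
Proof.
apply/symmetricmxP; rewrite /Aagg linear_sum /=; apply: eq_bigr => i _.
by rewrite linearZ /=; congr (_ *: _); apply/symmetricmxP.
Qed.

(** Conic duality without gap: the cone of the vectors lying below
    [- tr (A_i Z)] for some [Z] is closed, because an aggregate is positive definite, and
    hence equals the polar of [Gamma].  The matrix [Z] is a minimiser of the
    squared norm of the positive part of the constraint violation. *)
Lemma sdp_duality y : (exists2 g, Gamma A g & posdef (Aagg A g)) ->
  polar (Gamma A) y ->
  exists2 Z, psd Z & forall i, \tr (A i *m Z) + y i 0 <= 0.
Proof.
move=> [g0 [g0ge _] g0pd] hy.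
pose h i Z := \tr (A i *m Z) + y i 0.
pose f Z := \sum_i Num.max 0 (h i Z) ^+ 2.
have cf : continuous f.
  apply: (@sum_continuous R) => i.
  have cm : continuous (fun Z => Num.max 0 (h i Z)).
    move=> Z; apply: (@continuous_max _ _ (fun=> 0) (h i)); first exact: cst_continuous.
    apply: (@continuousD R R^o _ (fun Z => \tr (A i *m Z)) (fun=> y i 0) Z).
      exact: continuous_mxtrace_mul.
    exact: cst_continuous.
  by move=> Z; apply: (@continuousM R _ _ _ Z (cm Z) (cm Z)).
have f_ge0 i Z : 0 <= Num.max 0 (h i Z) by rewrite le_max lexx.
have [l l0 hl] := posdef_trace_coercive g0pd.
(* On a sublevel set each [h i] is at most [1 + f 0], which bounds the trace. *)
have [Z0 pZ0 minZ0] : exists2 Z0, psd Z0 & forall Z, psd Z -> f Z0 <= f Z.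
  apply: (psd_attains_min (B := l^-1 * \sum_i g0 i 0 * (1 + f 0 - y i 0))) cf _.
  move=> Z pZ fZ; rewrite mulrC ler_pdivlMr // mulrC.
  apply: le_trans (hl Z pZ) _; rewrite mxtrace_Aagg; apply: ler_sum => i _.
  apply: ler_wpM2l => //; rewrite lerBrDr.
  have hi : Num.max 0 (h i Z) ^+ 2 <= f 0.
    apply: le_trans fZ; rewrite /f (bigD1 i) //= lerDl.
    by apply: sumr_ge0 => j _; exact: sqr_ge0.
  have hh : h i Z <= Num.max 0 (h i Z) by rewrite le_max lexx orbT.
  have := f_ge0 i Z; rewrite -/(h i Z); nra.
pose r : 'cV[R]_m.+1 := \col_i Num.max 0 (h i Z0).
(* First-order optimality of [Z0] in a direction [D]. *)
have opt D : (forall e, 0 < e -> e <= 1 -> psd (Z0 + e *: D)) ->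
    0 <= \tr (Aagg A r *m D).
  move=> hD.
  suff : 0 <= 2 * \tr (Aagg A r *m D) by rewrite pmulr_rge0.
  pose C := \sum_i \tr (A i *m D) ^+ 2.
  have C0 : 0 <= C by apply: sumr_ge0 => i _; exact: sqr_ge0.
  have step e : 0 < e -> e <= 1 -> 0 <= e * (2 * \tr (Aagg A r *m D)) + e ^+ 2 * C.
    move=> e0 e1; have := minZ0 _ (hD e e0 e1); rewrite -subr_ge0 => /le_trans; apply.
    rewrite lerBlDl mxtrace_Aagg !mulr_sumr /f -!big_split /=.
    apply: ler_sum => i _.
    have -> : h i (Z0 + e *: D) = h i Z0 + e * \tr (A i *m D).
      by rewrite /h mulmxDr linearD /= -scalemxAr linearZ /= addrAC.
    apply: le_trans (sqr_pospart_le _ _) _; rewrite mxE.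
    by rewrite le_eqVlt; apply/orP; left; apply/eqP; ring.
  apply: (@quadratic_perturbation_ge0 _ _ (C + `|2 * \tr (Aagg A r *m D)|)) => e e0.
  (* The extra [|s|] in the quadratic coefficient makes the bound hold for [e > 1]. *)
  set s := 2 * _; rewrite -/s in step.
  have [e1|e1] := leP e 1.
    apply: le_trans (step e e0 e1) _; rewrite lerD2l; apply: ler_wpM2l.
      exact: sqr_ge0.
    by rewrite lerDl.
  have s0 : 0 <= s + `|s| by rewrite -lerBlDr sub0r lerNl -normrN ler_norm.
  have -> : e * s + e ^+ 2 * (C + `|s|) =
      e * (s + `|s|) + e ^+ 2 * C + e * (e - 1) * `|s| by ring.
  rewrite !addr_ge0 // !mulr_ge0 ?subr_ge0 ?exprn_ge0 //; exact: ltW.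
have rG : Gamma A r.
  split; first by move=> i; rewrite mxE.
  split; first exact: Aagg_sym.
  move=> x; rewrite -mxtrace_outer; apply: opt => e e0 _.
  by apply: psdD => //; apply: psdZ; [exact: ltW | exact: psd_outer].
(* Shrinking [Z0] towards [0] is a feasible direction. *)
have rZ0 : \tr (Aagg A r *m Z0) <= 0.
  rewrite -oppr_ge0 -linearN /= -mulmxN; apply: opt => e e0 e1.
  rewrite scalerN -{1}[Z0]scale1r -scalerBl; apply: psdZ => //.
  by rewrite subr_ge0.
(* [r] is orthogonal to the difference between itself and the violation. *)
have rr : dot r r = \tr (Aagg A r *m Z0) + dot y r.
  rewrite mxtrace_Aagg !dotE -big_split /=; apply: eq_bigr => i _.
  rewrite [y i 0 * _]mulrC -mulrDr -/(h i Z0) mxE.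
  by case: leP => // _; rewrite !mul0r.
have r0 : r = 0.
  apply/eqP; rewrite -dot_eq0 eq_le dot_ge0 andbT rr.
  by rewrite -[0]addr0 lerD // hy.
exists Z0 => // i; rewrite -/(h i Z0).
have : r i 0 = 0 by rewrite r0 mxE.
by rewrite mxE => r0i; rewrite -[leRHS]r0i le_max lexx orbT.
Qed.

End ConicDuality.

(** * Faces of convex cones *)

(** Convexity with a real barycentric weight and explicit bounds, instead of a
    weight in the subtype of the unit interval. *)
Lemma convex_setP (R : realType) (V : lmodType R) (E : set V) :
  @convex_set R V E <-> forall x y (k : R), E x -> E y -> 0 <= k <= 1 ->
    E (k *: x + (1 - k) *: y).
Proof.
split=> [cE x y k Ex Ey /andP[k0 k1]|h x y k /set_mem Ex /set_mem Ey].
  by have /set_mem := cE x y (Itv01 k0 k1) (mem_set Ex) (mem_set Ey).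
by apply/mem_set/h => //; apply/andP; split; [exact: ge0 | exact: le1].
Qed.

Section Cone.
Variables (R : realType) (V : vectType R).
Implicit Types (K L : set V) (x y z v w : V).

(** Convex cones with apex at the origin, which belongs to the cone. *)
Definition convex_cone K := K 0 /\ forall x y (a b : R),
  K x -> K y -> 0 <= a -> 0 <= b -> K (a *: x + b *: y).

Lemma convex_coneZ K x (a : R) : convex_cone K -> K x -> 0 <= a -> K (a *: x).
Proof.
by move=> [K0 h] Kx a0; rewrite -[_ *: x]addr0 -[0](scale0r 0); apply: h.
Qed.

Lemma convex_coneD K x y : convex_cone K -> K x -> K y -> K (x + y).
Proof.
by move=> [_ h] Kx Ky; rewrite -[x]scale1r -[y]scale1r; apply: h.
Qed.

(** Directions in which [y] can be moved both ways by a positive amount inside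
    [K].  For [y] in a convex cone this is the linear span of the minimal face
    of [y]; only the inclusion of that span in it is needed. *)
Definition face_dirs K y : set V :=
  [set v | exists2 e : R, 0 < e & K (y + e *: v) /\ K (y - e *: v)].

(** A set closed under linear combinations in a finite-dimensional space is a
    subspace: one of maximal dimension among the subspaces it contains. *)
Lemma subspace_vspace L : L 0 ->
  (forall a x y, L x -> L y -> L (a *: x + y)) ->
  exists U : {vspace V}, forall v, v \in U <-> L v.
Proof.
move=> L0 hL.
pose P k := `[< exists2 U : {vspace V}, {subset U <= [set` [pred v | `[< L v >]]]} & \dim U = k >].
have exP : exists k, P k.
  exists 0%N; apply/asboolP; exists 0%VS; last exact: dimv0.
  by move=> v; rewrite memv0 => /eqP ->; apply/mem_set/asboolP.
have ubP k : P k -> (k <= \dim {:V})%N.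
  by move=> /asboolP [U _ <-]; exact/dimvS/subvf.
case: (ex_maxnP exP ubP) => k /asboolP [U UL dU] maxk.
have UL' v : v \in U -> L v by move=> /UL /set_mem /asboolP.
exists U => v; split; first exact: UL'.
move=> Lv; apply: contrapT => /negP vU.
suff : (k < k)%N by rewrite ltnn.
have : P (\dim (U + <[v]>)%VS).
  apply/asboolP; exists (U + <[v]>)%VS => // w /memv_addP [u uU [_ /vlineP [a ->] ->]].
  by apply/mem_set/asboolP; rewrite addrC; apply: hL => //; exact: UL'.
move=> /maxk; apply: leq_trans; rewrite -dU.
rewrite (ltn_leqif (dimv_leqif_sup (addvSl U <[v]>))).
by apply: contra vU => /subvP; apply; rewrite memvE addvSr.
Qed.

Section AtPoint.
Variables (K : set V) (y : V).
Hypotheses (hK : convex_cone K) (Ky : K y).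

Lemma cone_step_shrink v (e e' : R) : K (y + e *: v) -> 0 <= e' <= e ->
  K (y + e' *: v).
Proof.
move=> Kv /andP[e'0 e'e]; have [->|en] := eqVneq e' 0; first by rewrite scale0r addr0.
have e0 : 0 < e by apply: lt_le_trans e'e; rewrite lt_def en.
have -> : y + e' *: v = (1 - e' / e) *: y + (e' / e) *: (y + e *: v).
  by rewrite scalerDr addrA -scalerDl subrK scale1r scalerA divfK // gt_eqF.
apply: (proj2 hK) => //; last by rewrite divr_ge0 // ltW.
by rewrite subr_ge0 ler_pdivrMr // mul1r.
Qed.

Lemma face_dirs0 : face_dirs K y 0.
Proof. by exists 1 => //; rewrite scaler0 subr0 addr0. Qed.

Lemma face_dirs_point : face_dirs K y y.
Proof.
by exists 1 => //; rewrite scale1r subrr; split; [exact: convex_coneD | case: hK].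
Qed.

Lemma face_dirsZ a v : face_dirs K y v -> face_dirs K y (a *: v).
Proof.
move=> [e e0 [Kp Km]].
have [->|a0] := eqVneq a 0; first by rewrite scale0r; exact: face_dirs0.
exists (e / `|a|); first by rewrite divr_gt0 // normr_gt0.
rewrite scalerA; case: (ltgtP a 0) a0 => // ha _.
  by rewrite ltr0_norm // invrN mulrN mulNr divfK ?lt_eqF // scaleNr opprK.
by rewrite gtr0_norm // divfK ?gt_eqF.
Qed.

Lemma face_dirsD v w :
  face_dirs K y v -> face_dirs K y w -> face_dirs K y (v + w).
Proof.
move=> [e e0 [vp vm]] [d d0 [wp wm]].
pose c := Num.min e d; have c0 : 0 < c by rewrite /c lt_min e0.
have ce : 0 <= c <= e by rewrite (ltW c0) /c ge_min lexx.
have cd : 0 <= c <= d by rewrite (ltW c0) /c ge_min lexx orbT.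
have half (p q : V) : K (y + c *: p) -> K (y + c *: q) -> K (y + (c / 2) *: (p + q)).
  move=> Kp Kq; have -> : y + (c / 2) *: (p + q) =
      2^-1 *: (y + c *: p) + 2^-1 *: (y + c *: q).
    rewrite !scalerDr !scalerA [2^-1 * c]mulrC addrACA -scalerDl.
    by rewrite (_ : 2^-1 + 2^-1 = 1) ?scale1r //; field.
  by apply: (proj2 hK) => //; rewrite invr_ge0.
exists (c / 2); first by rewrite divr_gt0.
rewrite -scalerN opprD; split; apply: half.
- exact: cone_step_shrink vp ce.
- exact: cone_step_shrink wp cd.
- by apply: cone_step_shrink ce; rewrite scalerN.
- by apply: cone_step_shrink cd; rewrite scalerN.
Qed.

Lemma face_dirs_sum (s : seq V) v : (forall u, u \in s -> face_dirs K y u) ->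
  v \in <<s>>%VS -> face_dirs K y v.
Proof.
elim: s v => [|u s IH] v hs.
  by rewrite span_nil memv0 => /eqP ->; exact: face_dirs0.
rewrite span_cons => /memv_addP [_ /vlineP [a ->] [w ws ->]].
apply: face_dirsD; first by apply/face_dirsZ/hs; rewrite mem_head.
by apply: IH ws => x xs; apply: hs; rewrite in_cons xs orbT.
Qed.

(** For members of the cone the forward movement is always possible. *)
Lemma face_dirs_cone z : K z ->
  face_dirs K y z <-> exists2 e : R, 0 < e & K (y - e *: z).
Proof.
move=> Kz; split=> [[e e0 [_ ?]]|[e e0 h]]; exists e => //; split => //.
by apply: convex_coneD => //; apply: convex_coneZ => //; exact: ltW.
Qed.

Lemma is_face_dirs : is_face K (K `&` face_dirs K y).
Proof.
split; first by exists y; split => //; exact: face_dirs_point.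
- by move=> z [].
- apply/convex_setP => x z k [Kx fx] [Kz fz] /andP[k0 k1].
  split; first by apply: (proj2 hK) => //; rewrite subr_ge0.
  by apply: face_dirsD; exact: face_dirsZ.
move=> x z k Kx Kz /andP[k0 k1] [_ [e e0 [_ h]]].
have k1' : 0 < 1 - k by rewrite subr_gt0.
split; split => //; apply/face_dirs_cone => //.
  exists (e * k); first exact: mulr_gt0.
  have := convex_coneD hK h (convex_coneZ hK Kz (ltW (mulr_gt0 e0 k1'))).
  by rewrite scalerDr !scalerA opprD addrA subrK.
exists (e * (1 - k)); first exact: mulr_gt0.
have := convex_coneD hK h (convex_coneZ hK Kx (ltW (mulr_gt0 e0 k0))).
by rewrite scalerDr !scalerA opprD [- _ - _]addrC addrA subrK.
Qed.

Lemma lspan_min_face_sub : lspan (min_face K y) `<=` face_dirs K y.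
Proof.
move=> v [s [hs vs]]; apply: face_dirs_sum vs => u /hs hu.
have [] := hu _ (conj is_face_dirs _) => //.
by move=> _ ->; split => //; exact: face_dirs_point.
Qed.

(** The space of directions can only shrink on passing to another point of the
    same face. *)
Lemma face_dirs_trans z : K z -> face_dirs K y z ->
  face_dirs K z `<=` face_dirs K y.
Proof.
move=> Kz /(face_dirs_cone Kz) [e e0 hz] v [d d0 [vp vm]].
exists (e * d); first exact: mulr_gt0.
have e0' := ltW e0.
have := convex_coneD hK hz (convex_coneZ hK vp e0').
have := convex_coneD hK hz (convex_coneZ hK vm e0').
by rewrite !scalerDr scalerN !scalerA !addrA !subrK.
Qed.

End AtPoint.
End Cone.

Section Polar.
Variables (R : realType) (k : nat) (C : set 'cV[R]_k).

Lemma polar_convex_cone : convex_cone (polar C).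
Proof.
split=> [g _|x y a b hx hy a0 b0 g Cg]; first by rewrite dot0l.
by rewrite dotDl !dotZl -[0]addr0 lerD // mulr_ge0_le0 // (hx, hy).
Qed.

(** A quadratic path that stays in a polar cone for parameters arbitrarily close
    to [sup T] is in the cone at [sup T]. *)
Lemma polar_quadratic_closed y u w (T : set R) : has_sup T ->
  (forall a, T a -> 0 <= a /\ polar C (y + a *: u + a ^+ 2 *: w)) ->
  polar C (y + sup T *: u + sup T ^+ 2 *: w).
Proof.
move=> hT TC g Cg; set s := sup T.
rewrite leNgt; apply/negP => pos.
rewrite !dotDl !dotZl in pos.
set p := dot y g in pos; set q := dot u g in pos; set r := dot w g in pos.
have [t Tt] : T !=set0 by case: hT.
have ub b : T b -> b <= s by move=> Tb; exact: sup_upper_bound.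
have s0 : 0 <= s by apply: le_trans (ub t Tt); case: (TC t Tt).
(* [D] bounds the slope of [p + a q + a^2 r] between [s] and any smaller
   nonnegative parameter. *)
pose D := 1 + `|q| + 2 * `|r| * s.
have D0 : 0 < D by rewrite /D; have := normr_ge0 q; have := normr_ge0 r; nra.
have [b Tb sb] := sup_adherent (divr_gt0 pos D0) hT.
have [b0 /(_ g Cg)] := TC b Tb; rewrite !dotDl !dotZl -/p -/q -/r => neg.
have bs := ub b Tb.
have slope : q + r * (s + b) <= D.
  have := ler_norm q; have := ler_norm r; have := normr_ge0 r; rewrite /D; nra.
have : (s - b) * D < p + s * q + s ^+ 2 * r.
  by rewrite -ltr_pdivlMr // ltrBlDr -ltrBlDl.
have : (s - b) * (q + r * (s + b)) <= (s - b) * D.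
  by apply: ler_wpM2l => //; rewrite subr_ge0.
by nra.
Qed.

(** A parabola in [y + face_dirs K y] that eventually leaves the polar cone [K]
    has a point [z] in [K] with strictly fewer free directions: if [u] and [w]
    were still free at the last parameter [a] inside the cone, the path could be
    continued beyond [a]. *)
Lemma polar_exit y u w (M : R) : polar C y ->
  face_dirs (polar C) y u -> face_dirs (polar C) y w ->
  (forall a, 0 <= a -> polar C (y + a *: u + a ^+ 2 *: w) -> a <= M) ->
  exists a : R, let z := y + a *: u + a ^+ 2 *: w in
    [/\ 0 <= a, polar C z, face_dirs (polar C) z `<=` face_dirs (polar C) y
      & exists2 v, face_dirs (polar C) y v & ~ face_dirs (polar C) z v].
Proof.
move=> Ky fu fw bM; have hK := polar_convex_cone.
pose T : set R := [set a | 0 <= a /\ polar C (y + a *: u + a ^+ 2 *: w)].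
have T0 : T 0 by split => //; rewrite expr0n /= !scale0r !addr0.
have hT : has_sup T.
  by split; [exists 0 | exists M => a [a0 ha]; exact: bM].
set a := sup T.
have a0 : 0 <= a by exact: sup_upper_bound.
have Kz : polar C (y + a *: u + a ^+ 2 *: w) by exact: polar_quadratic_closed.
exists a; set z := _ + _ in Kz *.
have fz : face_dirs (polar C) y z.
  apply: face_dirsD => //; last exact: face_dirsZ.
  by apply: face_dirsD => //; [exact: face_dirs_point | exact: face_dirsZ].
split => //; first exact: face_dirs_trans.
apply: contrapT => hn.
have sub v : face_dirs (polar C) y v -> face_dirs (polar C) z v.
  by move=> fv; apply: contrapT => nv; apply: hn; exists v.
have fw' := sub w fw.
(* At parameter [a + h] the path is [z + h (u + 2 a w) + h^2 w]. *)
have fp : face_dirs (polar C) z (u + (2 * a) *: w).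
  by apply: face_dirsD => //; [exact: sub | exact: face_dirsZ].
have [e e0 [ep _]] := fp; have [d d0 [dp _]] := fw'.
pose h := Num.min 1 (Num.min (e / 2) (d / 2)).
have h0 : 0 < h by rewrite /h !lt_min ltr01 !divr_gt0.
have h1 : h <= 1 by rewrite /h ge_min lexx.
have he : 2 * h <= e by rewrite mulrC -ler_pdivlMr // /h !ge_min lexx !orbT.
have hd : 2 * h <= d by rewrite mulrC -ler_pdivlMr // /h !ge_min lexx !orbT.
have K1 : polar C (z + (2 * h) *: (u + (2 * a) *: w)).
  by apply: cone_step_shrink ep _ => //; rewrite he mulr_ge0 // ltW.
have K2 : polar C (z + (2 * h ^+ 2) *: w).
  apply: cone_step_shrink dp _ => //; rewrite mulr_ge0 ?sqr_ge0 //=; nra.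
have : T (a + h).
  split; first by rewrite addr_ge0 // ltW.
  have i2 : 0 <= 2^-1 :> R by rewrite invr_ge0.
  have := proj2 hK _ _ _ _ K1 K2 i2 i2; congr polar.
  rewrite /z; apply/matrixP => i j; rewrite !mxE; by field.
move=> Tah; have : a + h <= a by exact: sup_upper_bound.
by rewrite gerDl leNgt h0.
Qed.

End Polar.

(** * The epigraph and its relaxation *)

Section ConvexHull.
Variables (R : realType) (V : lmodType R).
Implicit Types (E : set V).

Lemma sub_conv_hull E : E `<=` conv_hull E.
Proof. by move=> x Ex F [_]; apply. Qed.

Lemma conv_hull_convex E x y (k : R) : conv_hull E x -> conv_hull E y ->
  0 <= k <= 1 -> conv_hull E (k *: x + (1 - k) *: y).
Proof.
move=> hx hy k01 F hF; have [/convex_setP cF _] := hF.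
by apply: cF k01; [exact: hx | exact: hy].
Qed.

Lemma conv_hull_min E F : @convex_set R V F -> E `<=` F -> conv_hull E `<=` F.
Proof. by move=> cF EF x; apply. Qed.

(** A translation that preserves a set preserves its convex hull. *)
Lemma conv_hull_recession E d : (forall x, E x -> E (x + d)) ->
  forall x, conv_hull E x -> conv_hull E (x + d).
Proof.
move=> hd; apply: (@conv_hull_min E [set x | conv_hull E (x + d)]).
  apply/convex_setP => x y k /= hx hy k01.
  have := conv_hull_convex hx hy k01; congr (conv_hull E).
  by rewrite !scalerDr addrACA -scalerDl subrKC scale1r.
by move=> x /hd; exact: sub_conv_hull.
Qed.

End ConvexHull.

Section QuadraticProgram.
Variables (R : realType) (n m : nat).
Variables (A : 'I_m.+1 -> 'M[R]_n) (b : 'I_m.+1 -> 'cV[R]_n) (c : 'I_m.+1 -> R).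
Hypothesis hA : forall i, A i \is symmetricmx.
Local Notation point := ('cV[R]_n * R^o)%type.
Implicit Types (p d : point).

(** The vector [q(x) - 2 t e_0] of the point [p = (x, t)]. *)
Definition epi_vec p : 'cV[R]_m.+1 := qvec A b c p.1 - (2 * p.2) *: e0 R m.

(** The linear and quadratic coefficients of [a |-> epi_vec (p + a *: d)]. *)
Definition epi_vec1 p d : 'cV[R]_m.+1 :=
  \col_i (2 * dot p.1 (A i *m d.1) + 2 * dot (b i) d.1) - (2 * d.2) *: e0 R m.

Definition epi_vec2 d : 'cV[R]_m.+1 := \col_i dot d.1 (A i *m d.1).

Lemma epi_vec_line p d (a : R) :
  epi_vec (p + a *: d) = epi_vec p + a *: epi_vec1 p d + a ^+ 2 *: epi_vec2 d.
Proof.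
apply/matrixP => i j; rewrite ord1 !mxE /quad /= quadratic_form_line //.
rewrite dotDr dotZr -[a *: d.2]/(a * d.2); ring.
Qed.

Lemma dot_epi_vec_line p d (a : R) g : dot (epi_vec (p + a *: d)) g =
  dot (epi_vec p) g + a * dot (epi_vec1 p d) g + a ^+ 2 * dot (epi_vec2 d) g.
Proof. by rewrite epi_vec_line dotDl dotZl [in LHS]dotDl dotZl. Qed.

Lemma epi_vec2_form d g : dot (epi_vec2 d) g = dot d.1 (Aagg A g *m d.1).
Proof.
by rewrite dotE Aagg_form; apply: eq_bigr => i _; rewrite mxE mulrC.
Qed.

Lemma epi_vec_ord0 p : epi_vec p ord0 0 = quad A b c ord0 p.1 - 2 * p.2.
Proof. by rewrite /epi_vec !mxE !eqxx mulr1. Qed.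

Lemma epi_vec_lift p j : epi_vec p (lift ord0 j) 0 = quad A b c (lift ord0 j) p.1.
Proof.
by rewrite /epi_vec !mxE [lift _ _ == _]eq_sym (negbTE (neq_lift _ _)) mulr0 subr0.
Qed.

Lemma epiP p : epi A b c p <-> forall i, epi_vec p i 0 <= 0.
Proof.
split=> [[h0 h] i|h].
  case: (unliftP ord0 i) => [j|] ->; first by rewrite epi_vec_lift.
  by rewrite epi_vec_ord0 subr_le0.
split=> [|j]; first by have := h ord0; rewrite epi_vec_ord0 subr_le0.
by have := h (lift ord0 j); rewrite epi_vec_lift.
Qed.

(** The relaxation in terms of the slack matrix [Z = X - x x^T]. *)
Lemma epi_sdpP p : epi_sdp A b c p <->
  exists2 Z, psd Z & forall i, \tr (A i *m Z) + epi_vec p i 0 <= 0.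
Proof.
have liftedE i X : lifted A b c i X p.1 =
    \tr (A i *m (X - p.1 *m p.1^T)) + quad A b c i p.1.
  rewrite /lifted /quad mulmxBr linearB /= mxtrace_outer; ring.
split=> [[X [sX pX h0 h]]|[Z pZ h]].
  exists (X - p.1 *m p.1^T) => // i.
  case: (unliftP ord0 i) => [j|] ->; first by rewrite epi_vec_lift -liftedE.
  by rewrite epi_vec_ord0 addrA -liftedE subr_le0.
exists (Z + p.1 *m p.1^T); split.
- by apply: symD; [case: pZ | exact: outer_sym].
- by rewrite addrK.
- by have := h ord0; rewrite epi_vec_ord0 addrA subr_le0 liftedE addrK.
by move=> j; have := h (lift ord0 j); rewrite liftedE addrK epi_vec_lift.
Qed.

Lemma epi_sub_sdp : epi A b c `<=` epi_sdp A b c.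
Proof.
move=> p /epiP h; apply/epi_sdpP; exists 0; first exact: psd0.
by move=> i; rewrite mulmx0 linear0 add0r.
Qed.

Lemma posdef_perturbation (P Q : 'M[R]_n) : posdef P -> Q \is symmetricmx ->
  exists2 e : R, 0 < e & posdef (P + e *: Q).
Proof.
move=> hP sQ; have [l l0 hl] := posdef_coercive hP.
have [M M0 hM] := quadratic_form_ge Q.
exists (l / (2 * M)); first by rewrite divr_gt0 ?mulr_gt0.
split; first by apply: symD; [case: hP | exact: symZ].
move=> x /dot_gt0 x0; rewrite quadratic_formD quadratic_formZ.
have e0 : 0 <= l / (2 * M) by rewrite divr_ge0 ?mulr_ge0 // ltW.
have := ler_wpM2l e0 (hM x).
have -> : l / (2 * M) * (- M * dot x x) = - (l / 2 * dot x x).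
  by field; rewrite gt_eqF.
move=> h2; have := hl x; have := mulr_gt0 l0 x0; lra.
Qed.

(** Adding a small multiple of [e_0] keeps the aggregate positive definite. *)
Lemma Gamma_posdef_objective : (exists2 g, Gamma A g & posdef (Aagg A g)) ->
  exists g, [/\ Gamma A g, posdef (Aagg A g) & 0 < g ord0 0].
Proof.
move=> [g [g0 _] pd]; have [e epos pe] := posdef_perturbation pd (hA ord0).
have AE : Aagg A (g + e *: e0 R m) = Aagg A g + e *: A ord0.
  rewrite /Aagg (bigD1 ord0) //= [in RHS](bigD1 ord0) //= !mxE eqxx mulr1.
  rewrite scalerDl addrAC; congr (_ + _ + _).
  by apply: eq_bigr => i i0; rewrite !mxE (negbTE i0) mulr0 addr0.
exists (g + e *: e0 R m); rewrite AE; split => //.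
  split; last by rewrite AE; exact: posdef_psd.
  move=> i; rewrite !mxE addr_ge0 // mulr_ge0 //; exact: ltW.
by rewrite !mxE eqxx mulr1 ltr_wpDl.
Qed.

Section Interior.
Hypothesis hpos : exists2 g, Gamma A g & posdef (Aagg A g).
Local Notation K := (polar (Gamma A)).

Lemma epi_sdp_polar p : epi_sdp A b c p <-> K (epi_vec p).
Proof.
rewrite epi_sdpP; split => [[Z pZ h] g [g0 [_ pg]]|hy]; last exact: sdp_duality.
have := mxtrace_psd_ge0 pg pZ; rewrite mxtrace_Aagg dotE -oppr_le0 => h0.
apply: le_trans h0; rewrite -sumrN; apply: ler_sum => i _.
by rewrite -mulrN mulrC ler_wpM2l ?g0 // -subr_le0 opprK addrC.
Qed.

(** By [epi_sdp_polar] the relaxation is cut out by the pairings with the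
    multipliers in [Gamma], which are convex functions of the point. *)
Lemma convex_epi_sdp : @convex_set R point (epi_sdp A b c).
Proof.
apply/convex_setP => x y k /epi_sdp_polar hx /epi_sdp_polar hy /andP[k0 k1].
apply/epi_sdp_polar => g Gg.
pose d : point := x - y.
have -> : k *: x + (1 - k) *: y = y + k *: d.
  by rewrite /d scalerBr scalerBl scale1r addrCA.
have := hx g Gg; have -> : x = y + 1 *: d by rewrite scale1r /d addrC subrK.
rewrite (dot_epi_vec_line y d 1) (dot_epi_vec_line y d k); have := hy g Gg; rewrite epi_vec2_form.
have := (proj2 (proj2 Gg)) d.1.
set f := dot _ _; set p0 := dot _ _; set p1 := dot _ _ => f0 h0 h1.
have : 0 <= k * (1 - k) * f by rewrite !mulr_ge0 ?subr_ge0.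
have : (1 - k) * p0 <= 0 by rewrite mulr_ge0_le0 ?subr_ge0.
have := mulr_ge0_le0 k0 h1; nra.
Qed.

Lemma quadratic_bounded (p q r : R) : 0 < r \/ (r = 0 /\ 0 < q) ->
  exists M, forall a, 0 <= a -> p + a * q + a ^+ 2 * r <= 0 -> a <= M.
Proof.
case=> [r0|[-> q0]].
  exists (1 + (`|p| + `|q|) / r) => a a0 h; rewrite leNgt; apply/negP => aM.
  have aM1 : 1 < a.
    by apply: le_lt_trans aM; rewrite lerDl divr_ge0 ?addr_ge0 // ltW.
  have : `|p| + `|q| < a * r.
    rewrite -ltr_pdivrMr //; apply: le_lt_trans aM; rewrite lerDr //.
  have := lerNnormlW (lexx `|p|); have := lerNnormlW (lexx `|q|); have := normr_ge0 p; nra.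
exists (- p / q) => a a0; rewrite mulr0 addr0 => h.
by rewrite ler_pdivlMr // -subr_le0 opprK addrC.
Qed.

(** Along a direction that is not vertical, or is vertical and points downwards,
    the path leaves the polar cone.  One multiplier serves for both cases: its
    aggregate is positive definite, which settles the quadratic coefficient, and
    its objective weight is positive, which settles a vertical slope. *)
Lemma epi_vec_bounded p d : d.1 != 0 \/ (d.1 = 0 /\ d.2 < 0) ->
  exists M, forall a, 0 <= a ->
    K (epi_vec p + a *: epi_vec1 p d + a ^+ 2 *: epi_vec2 d) -> a <= M.
Proof.
move=> hd; have [g [Gg pg g0]] := Gamma_posdef_objective hpos.
have [|M hM] := @quadratic_bounded (dot (epi_vec p) g) (dot (epi_vec1 p d) g)
    (dot (epi_vec2 d) g).
  rewrite epi_vec2_form; case: hd => [d0|[d0 t0]]; first by left; apply: (proj2 pg).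
  right; rewrite d0 mulmx0 dot0r; split => //.
  rewrite dotE (bigD1 ord0) //= big1 => [|i i0].
    rewrite addr0 !mxE d0 !mulmx0 !dot0r !mulr0 addr0 add0r eqxx mulr1.
    by rewrite pmulr_rgt0 ?oppr_gt0 // mulrC; nra.
  by rewrite !mxE d0 !mulmx0 !dot0r (negbTE i0) !mulr0 subr0 addr0 mul0r.
exists M => a a0; rewrite -epi_vec_line => /(_ g Gg).
by rewrite dot_epi_vec_line; exact: hM.
Qed.

(** Along a direction of [Rprime p] both coefficients of the path are free
    directions, being combinations of its values at [1], [0] and [-1]. *)
Lemma Rprime_face_dirs p d : K (epi_vec p) -> Rprime A b c p d ->
  face_dirs K (epi_vec p) (epi_vec1 p d) /\ face_dirs K (epi_vec p) (epi_vec2 d).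
Proof.
move=> Kp hd; have hK := polar_convex_cone (Gamma A).
have fd a : face_dirs K (epi_vec p) (epi_vec (p + a *: d)).
  exact: (lspan_min_face_sub hK Kp (hd a)).
have f0 := face_dirs_point hK Kp.
have f1 := fd 1; have fm := fd (-1); rewrite !epi_vec_line in f1 fm.
have eqU (y u w : 'cV[R]_m.+1) : u = 2^-1 *: ((y + 1 *: u + 1 ^+ 2 *: w)
    + -1 *: (y + -1 *: u + (-1) ^+ 2 *: w)).
  by apply/matrixP => i j; rewrite !mxE; field.
have eqW (y u w : 'cV[R]_m.+1) : w = 2^-1 *: ((y + 1 *: u + 1 ^+ 2 *: w)
    + (y + -1 *: u + (-1) ^+ 2 *: w)) + -1 *: y.
  by apply/matrixP => i j; rewrite !mxE; field.
split.
  rewrite (eqU (epi_vec p) (epi_vec1 p d) (epi_vec2 d)).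
  by apply: face_dirsZ => //; apply: face_dirsD => //; exact: face_dirsZ.
rewrite (eqW (epi_vec p) (epi_vec1 p d) (epi_vec2 d)).
apply: face_dirsD => //; last exact: face_dirsZ.
by apply: face_dirsZ => //; exact: face_dirsD.
Qed.

Lemma Rprime_nontrivial p : K (epi_vec p) -> Rprime A b c p <> [set 0] ->
  exists2 d, d != 0 & Rprime A b c p d.
Proof.
move=> Kp hR; apply: contrapT => hn; apply: hR; apply/seteqP; split=> [d hd|_ ->] /=.
  by apply: contrapT => d0; apply: hn; exists d => //; exact/eqP.
move=> a; exists [:: epi_vec p]; split.
  by move=> u; rewrite inE => /eqP -> F [_]; apply.
by rewrite /= scaler0 mulr0 !addr0 span_seq1 memv_line.
Qed.

Lemma epi_vec1N p d : epi_vec1 p (- d) = - epi_vec1 p d.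
Proof.
apply/matrixP => i j; rewrite ord1 !mxE /= mulmxN !dotNr; ring.
Qed.

Lemma epi_vec2N d : epi_vec2 (- d) = epi_vec2 d.
Proof. by apply/matrixP => i j; rewrite !mxE /= mulmxN dotNr dotNl opprK. Qed.

Lemma epi_upward p (s : R) : 0 <= s -> epi A b c p -> epi A b c (p + (0, s)).
Proof.
move=> s0 [h0 h]; split=> [|i] /=; last by rewrite addr0.
by rewrite addr0; apply: le_trans h0 _; rewrite mulrDr lerDl mulr_ge0.
Qed.

Lemma epi_sdp_sub_conv_hull :
  (forall p, (epi_sdp A b c `\` epi A b c) p -> Rprime A b c p <> [set 0]) ->
  epi_sdp A b c `<=` conv_hull (epi A b c : set point).
Proof.
move=> hR p0 /epi_sdp_polar Kp0; have hK := polar_convex_cone (Gamma A).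
(* Induction on a strict bound [N] for the dimension of the free directions. *)
suff ind N : forall p (U : {vspace 'cV[R]_m.+1}), K (epi_vec p) ->
    (forall v, face_dirs K (epi_vec p) v -> v \in U) -> (\dim U < N)%N ->
    conv_hull (epi A b c : set point) p.
  by apply: (ind _ p0 fullv Kp0 _ (ltnSn _)) => v _; exact: memvf.
elim: N => [|N IH] p U Kp hU dU; first by rewrite ltn0 in dU.
have [ep|nep] := pselect (epi A b c p); first exact: sub_conv_hull.
have [d d0 hd] : exists2 d, d != 0 & Rprime A b c p d.
  by apply: Rprime_nontrivial => //; apply: hR; split => //; exact/epi_sdp_polar.
have [f1 f2] := Rprime_face_dirs Kp hd.
(* The induction hypothesis applies where the path leaves the cone. *)
have exit e : face_dirs K (epi_vec p) (epi_vec1 p e) ->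
    face_dirs K (epi_vec p) (epi_vec2 e) -> e.1 != 0 \/ (e.1 = 0 /\ e.2 < 0) ->
    exists2 a : R, 0 <= a & conv_hull (epi A b c : set point) (p + a *: e).
  move=> g1 g2 /(epi_vec_bounded p) [M hM].
  have [a /= []] := polar_exit Kp g1 g2 hM.
  rewrite -epi_vec_line => a0 Kz sub [v vy vz]; exists a => //.
  have [U' hU'] := @subspace_vspace _ _ (face_dirs K (epi_vec (p + a *: e)))
    (face_dirs0 Kz) (fun t x y hx hy => face_dirsD hK Kz (face_dirsZ Kz t hx) hy).
  apply: (IH _ U' Kz) => [w|]; first by move/hU'.
  rewrite -ltnS; apply: leq_trans dU.
  have UU' : (U' <= U)%VS by apply/subvP => w /hU' /sub /hU.
  rewrite ltnS (ltn_leqif (dimv_leqif_sup UU')).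
  by apply/negP => /subvP /(_ v (hU _ vy)) /hU'.
have [d1|d1] := eqVneq d.1 0; last first.
  have [a a0 ha] := exit d f1 f2 (or_introl d1).
  have [| | |s s0 hs] := exit (- d).
  - by rewrite epi_vec1N -scaleN1r; exact: face_dirsZ.
  - by rewrite epi_vec2N.
  - by left; rewrite /= oppr_eq0.
  have [az|an] := eqVneq a 0; first by rewrite az scale0r addr0 in ha.
  have as0 : 0 < a + s by rewrite ltr_pwDl // lt_def an.
  (* [p] divides the segment between the two exit points in the ratio [a : s]. *)
  have := @conv_hull_convex _ _ _ _ _ (s / (a + s)) ha hs; rewrite scalerN.
  have -> : (s / (a + s)) *: (p + a *: d) + (1 - s / (a + s)) *: (p - s *: d) = p.
    rewrite !scalerDr addrACA -scalerDl subrKC scale1r scalerN -scaleNr !scalerA -scalerDl.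
    suff -> : s / (a + s) * a + - (1 - s / (a + s)) * s = 0 by rewrite scale0r addr0.
    by field; exact: lt0r_neq0.
  apply; rewrite divr_ge0 ?(ltW as0) //= ler_pdivrMr // mul1r lerDr //.
have d2 : d.2 != 0.
  by apply: contra d0 => /eqP d2; rewrite [d]surjective_pairing d1 d2.
have [e [g1 g2 e1 e2]] : exists e, [/\ face_dirs K (epi_vec p) (epi_vec1 p e),
    face_dirs K (epi_vec p) (epi_vec2 e), e.1 = 0 & e.2 < 0].
  case: (ltgtP d.2 0) d2 => // hd2 _; first by exists d.
  exists (- d); rewrite epi_vec1N epi_vec2N -scaleN1r; split => //=.
  - exact: face_dirsZ.
  - by rewrite d1 oppr0.
  - by rewrite oppr_lt0.
have [a a0 ha] := exit e g1 g2 (or_intror (conj e1 e2)).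
(* [p] is above the exit point, by [- a e.2]. *)
have s0 : 0 <= - (a * e.2) by rewrite oppr_ge0 mulr_ge0_le0 // ltW.
have := conv_hull_recession (fun x => @epi_upward x _ s0) ha.
congr (conv_hull _); rewrite [RHS]surjective_pairing; congr pair => /=.
  by rewrite e1 scaler0 !addr0.
by rewrite -[a *: e.2]/(a * e.2) addrK.
Qed.

End Interior.
End QuadraticProgram.

Unset Implicit Arguments.

Theorem theorem1 (R : realType) (n m : nat) (hn : (0 < n)%N) (hm : (0 < m)%N)
    (A : 'I_m.+1 -> 'M[R]_n) (b : 'I_m.+1 -> 'cV[R]_n) (c : 'I_m.+1 -> R)
    (hA : forall i, A i \is symmetricmx)
    (hpos : exists2 g, Gamma A g & posdef (Aagg A g))
    (hR : forall p : 'cV[R]_n * R^o,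
        (epi_sdp A b c `\` epi A b c) p -> Rprime A b c p <> [set 0]) :
  conv_hull (epi A b c) = epi_sdp A b c.
Proof.
apply/seteqP; split; last exact: epi_sdp_sub_conv_hull.
by apply: conv_hull_min; [exact: convex_epi_sdp | exact: epi_sub_sdp].
Qed.
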